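(* Let $\Omega$ be a non-void open subset of $\mathbb{C}^n$, $n\geqslant 1$, and let $g:\Omega\to\mathbb{R}$ be a first functional Lebesgue class function on $(\Omega,\tau)$, where $\tau$ is the pluri-fine topology on $\Omega$. Then there is a function $f:\Omega^2\to\mathbb{R}$ which is separately continuous with respect to the pluri-fine topology $\tau_2$ on $\Omega^2$ and such that $g$ is the diagonal of $f$, i.e. $g(x)=f(x,x)$ for every $x\in\Omega$.
   Context: Plurisubharmonic functions: for a non-void open set $U\subseteq\mathbb{C}^N$, $N\geqslant 1$ (with $\mathbb{C}^N$, $\mathbb{C}$, $[-\infty,\infty)$ carrying the Euclidean topologies), a function $u:U\to[-\infty,\infty)$ is plurisubharmonic (psh) if $u$ is upper semicontinuous and, for all $a,b\in\mathbb{C}^N$, the function $z\mapsto u(a+bz)$ is subharmonic or identically $-\infty$ on every connected component of $\{z\in\mathbb{C}: a+bz\in U\}$. The pluri-fine topology on $U$ is the coarsest topology on $U$ in which all psh functions $u:U\to[-\infty,\infty)$ are continuous. $\tau$ denotes the pluri-fine topology on $\Omega$. $\Omega^2$ is identified with the corresponding open subset of $\mathbb{C}^{2n}$, and $\tau_2$ denotes the pluri-fine topology on $\Omega^2$ (not the product topology). First functional Lebesgue class: a subset $A$ of a topological space $X$ is functionally closed if $A=h^{-1}(0)$ for some continuous $h:X\to[0,1]$. A function $g:X\to Y$ between topological spaces is a first functional Lebesgue class function if for every open $G\subseteq Y$ the set $g^{-1}(G)$ is a countable union of functionally closed subsets of $X$. $\mathbb{R}$ has the Euclidean topology. Separate continuity: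 a function $f:\Omega^2\to\mathbb{R}$ is separately continuous with respect to $\tau_2$ if, for each $(x_1,x_2)\in\Omega^2$, the restrictions of $f$ to the sets $\{(x,x_2):x\in\Omega\}$ and $\{(x_1,x):x\in\Omega\}$ are continuous in the subspace topologies induced by $\tau_2$. *)

(* Defs.v *)
From HB Require Import structures.
From mathcomp Require Import all_boot all_order all_algebra.
From mathcomp Require Import complex.
From mathcomp Require Import all_classical all_reals all_analysis.

Set Implicit Arguments.
Unset Strict Implicit.
Unset Printing Implicit Defensive.

Import Order.TTheory GRing.Theory Num.Theory.
Import numFieldNormedType.Exports.

Local Open Scope classical_set_scope.
Local Open Scope ring_scope.
Local Open Scope complex_scope.

(* The Euclidean topology on R[i], given by the modulus. *)
HB.instance Definition _ (R : rcfType) := NormedModule.copy R[i] R[i]^o.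

(* Functions on a set D with values in [-oo, +oo) are represented by total
   functions to \bar R whose values outside D are irrelevant. *)
Definition usc_on (R : realType) (X : topologicalType) (D : set X)
    (f : X -> \bar R) : Prop :=
  forall x a, D x -> (f x < a%:E)%E ->
    \forall y \near within D (nbhs x), (f y < a%:E)%E.

(* Submean inequality over every circle bounding a closed disc in V, for v
   upper semicontinuous and not identically -oo. The integrand is bounded
   above, so that the integral is well defined, with value in [-oo, +oo). *)
Definition subharmonic (R : realType) (V : set R[i]) (v : R[i] -> \bar R)
    : Prop :=
  [/\ forall z, V z -> (v z < +oo)%E,
      usc_on V v,
      exists2 z, V z & v z <> -oo%E
    & forall (c : R[i]) (r : R), 0 < r ->
        [set z | `|z - c| <= r%:C] `<=` V ->
        (v c <= ((2 * pi)^-1)%R%:E *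
           \int[lebesgue_measure]_(t in `[0%R, (2 * pi)%R])
              v (c + r%:C * (cos t +i* sin t))%R)%E].

Definition psh (R : realType) (N : nat) (U : set 'rV[R[i]]_N)
    (u : 'rV[R[i]]_N -> \bar R) : Prop :=
  [/\ forall x, U x -> (u x < +oo)%E,
      usc_on U u
    & forall (a b : 'rV[R[i]]_N) (z0 : R[i]), U (a + z0 *: b) ->
        let V := connected_component [set z | U (a + z *: b)] z0 in
        subharmonic V (fun z => u (a + z *: b)) \/
        (forall z, V z -> u (a + z *: b) = -oo%E)].

(* The type U with the coarsest topology making all psh functions on U
   continuous. As these do not take the value +oo, continuity into \bar R is
   continuity into the subspace [-oo, +oo). *)
Definition plurifine (R : realType) (N : nat) (U : set 'rV[R[i]]_N) : Type :=
  sup_topology (fun u : {u : 'rV[R[i]]_N -> \bar R | psh U u} =>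
    Topological.class (initial_topology (fun x : U => sval u (\val x)))).

HB.instance Definition _ (R : realType) (N : nat) (U : set 'rV[R[i]]_N) :=
  Topological.copy (plurifine U)
    (sup_topology (fun u : {u : 'rV[R[i]]_N -> \bar R | psh U u} =>
      Topological.class (initial_topology (fun x : U => sval u (\val x))))).

Definition functionally_closed (R : realType) (X : topologicalType)
    (A : set X) : Prop :=
  exists h : X -> R,
    [/\ continuous h, forall x, 0 <= h x <= 1 & A = h @^-1` [set 0]].

Definition first_functional_Lebesgue (R : realType) (X Y : topologicalType)
    (g : X -> Y) : Prop :=
  forall G : set Y, open G ->
    exists F : nat -> set X,
      (forall k, functionally_closed R (F k)) /\ g @^-1` G = \bigcup_k F k.

(* Om x Om as a subset of C^(2n). *)
Definition square (R : realType) (n : nat) (Om : set 'rV[R[i]]_n)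
    : set 'rV[R[i]]_(n + n) :=
  [set z | Om (lsubmx z) /\ Om (rsubmx z)].

Lemma square_row_mx (R : realType) (n : nat) (Om : set 'rV[R[i]]_n)
    (x y : Om) : row_mx (\val x) (\val y) \in square Om.
Proof.
by apply/mem_set; rewrite /square /= row_mxKl row_mxKr; split; apply: set_valP.
Qed.

Definition sqpair (R : realType) (n : nat) (Om : set 'rV[R[i]]_n)
    (x y : plurifine Om) : plurifine (square Om) :=
  exist (fun z => z \in square Om) _ (square_row_mx x y).

(* Continuity on the two lines through (x1, x2) is taken for the subspace
   topologies inherited from the pluri-fine topology of square Om. *)
Definition separately_continuous (R : realType) (n : nat)
    (Om : set 'rV[R[i]]_n) (f : plurifine (square Om) -> R) : Prop :=
  forall x1 x2 : plurifine Om,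
    {within range (fun x => sqpair x x2), continuous f} /\
    {within range (fun x => sqpair x1 x), continuous f}.

(* Main.v *)
Require Import Defs.
From HB Require Import structures.
From mathcomp Require Import all_boot all_order all_algebra.
From mathcomp Require Import complex ring lra.
From mathcomp Require Import all_classical all_reals all_analysis.

Set Implicit Arguments.
Unset Strict Implicit.
Unset Printing Implicit Defensive.

Import Order.TTheory GRing.Theory Num.Theory.
Import numFieldNormedType.Exports.

Local Open Scope classical_set_scope.
Local Open Scope ring_scope.
Local Open Scope complex_scope.

(** The statement splits into a purely topological part and a remark on
    plurisubharmonic functions.

    Topological part: on an arbitrary space X, a first functional Lebesgue class
    function g is the diagonal of a function F on X x X that is continuous in
    each variable ([separately_continuous_diagonal]). Such a g is the pointwise
    limit of continuous functions g_k ([first_functional_Lebesgue_limit], a form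
    of the Lebesgue-Hausdorff theorem). In place of a metric on X, the g_k
    themselves measure how close x and y are: F x y is a convex combination of
    the values g_k x ([blend]), and the more of the first differences
    g_j x - g_j y are small, the larger the indices k that occur in it. If some
    g_j separates x and y, then F is locally a finite sum of products of
    continuous functions. If none does, then g x = g y, and near such a point
    F x y is an average of values g_k x with k large; letting y vary these are
    close to g x by pointwise convergence at x, and letting x vary they are
    close to the corresponding g_k y, hence to g y, because an index k is only
    used when g_k x and g_k y are close. [blend_continuous] treats both
    variables at once.

    Plurisubharmonic part: composing a plurisubharmonic function with one of the
    two linear projections of C^n x C^n gives a plurisubharmonic function
    ([psh_comp_linear]), so the projections are continuous for the pluri-fine
    topologies, and F composed with them is separately continuous
    ([separately_continuous_sqpair]). *)

(** * Pointwise limits of continuous functions *)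

Lemma continuous_sumr (R : realType) (T : topologicalType) (I : Type)
    (r : seq I) (P : pred I) (F : I -> T -> R) :
  (forall i, P i -> continuous (F i)) ->
  continuous (fun x => \sum_(i <- r | P i) F i x).
Proof. by apply: continuous_big; exact: add_continuous. Qed.

Section Interpolation.
Variables (R : realType) (X : topologicalType) (n : nat).
Variables (r : 'I_n.+1 -> R) (a b : 'I_n.+1 -> X -> R).
Hypotheses (a_ge0 : forall i x, 0 <= a i x) (b_ge0 : forall i x, 0 <= b i x).
Hypotheses (ac : forall i, continuous (a i)) (bc : forall i, continuous (b i)).
Hypothesis ab : forall i j x, r i < r j -> a i x = 0 -> b j x = 0 -> False.

(* Above the level r i, each level r j > r i contributes a Urysohn function of
   height r j - r i, vanishing where a i does and full where b j vanishes. *)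
Let upper i x :=
  r i + \sum_(j | r i < r j) (r j - r i) * (a i x / (a i x + b j x)).

Let upper_cont i : continuous (upper i).
Proof.
move=> x; apply: cvgD; first exact: cvg_cst.
apply: continuous_sumr => j rij {}x.
apply: cvgM; first exact: cvg_cst.
apply: cvgM; first exact: ac.
apply: cvgV; last by apply: cvgD; [exact: ac|exact: bc].
apply/eqP => /eqP; rewrite paddr_eq0 // => /andP[/eqP a0 /eqP b0].
exact: ab rij a0 b0.
Qed.

(** The function f is the minimum of the functions upper i. It is at most r i
    where a i vanishes, because upper i equals r i there; where b i vanishes
    every upper k is at least r i, either because r k already is, or because
    the i-th term of the sum lifts r k up to r i. *)
Lemma interpolation : exists2 f : X -> R, continuous f &
  forall i x, (a i x = 0 -> f x <= r i) /\ (b i x = 0 -> r i <= f x).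
Proof.
exists (fun x => \big[Num.min/upper ord0 x]_i upper i x).
  have bmc (s : seq 'I_n.+1) :
      continuous (fun x => \big[Num.min/upper ord0 x]_(i <- s) upper i x).
    elim: s => [|i s IH] x.
      by under eq_fun do rewrite big_nil; exact: upper_cont.
    under eq_fun do rewrite big_cons.
    by apply: (@continuous_min _ _ (upper i)); [exact: upper_cont|exact: IH].
  exact: bmc.
move=> i x; split=> [a0|b0].
  apply: (le_trans (bigmin_le _ i _)).
  by rewrite /upper a0 big1 ?addr0 // => j _; rewrite mul0r mulr0.
have le_upper k : r i <= upper k x.
  have term_ge0 j : r k < r j -> 0 <= (r j - r k) * (a k x / (a k x + b j x)).
    move=> rkj; apply: mulr_ge0; first by rewrite subr_ge0 ltW.
    by rewrite divr_ge0 // addr_ge0.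
  have [rki|rik] := ltP (r k) (r i); last first.
    by apply: (le_trans rik); rewrite lerDl sumr_ge0.
  rewrite /upper (bigD1 i) //= b0 addr0 divff; last first.
    by apply/eqP => a0; exact: ab rki a0 b0.
  rewrite mulr1 addrA addrCA subrr addr0 lerDl sumr_ge0 // => j.
  by case/andP => /term_ge0.
exact: le_bigmin.
Qed.

End Interpolation.

(** Products of the functions cutting out the first k + 1 zero sets turn the
    countable union into an increasing one, so that a point of the preimage of
    G is eventually detected, once and for all. *)
Lemma functional_Fsigma_detect (R : realType) (X : topologicalType) (g : X -> R)
    (G : set R) :
  first_functional_Lebesgue R g -> open G ->
  exists a : nat -> X -> R,
    [/\ forall k, continuous (a k), forall k x, 0 <= a k x,
        forall k x, a k x = 0 -> G (g x)
      & forall x, G (g x) -> \forall k \near \oo, a k x = 0].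
Proof.
move=> hg /hg[F [/choice[h hP] gF]].
exists (fun k x => \prod_(j < k.+1) h j x); split.
- move=> k; apply: continuous_big => [|j _]; first exact: mul_continuous.
  by case: (hP j).
- move=> k x; apply: prodr_ge0 => j _.
  by case: (hP j) => _ /(_ x) /andP[].
- move=> k x /eqP /prodf_eq0[j _ /eqP hj].
  have : (\bigcup_k F k) x by exists (j : nat) => //; case: (hP j) => _ _ ->.
  by rewrite -gF.
- move=> x Gx; have : (\bigcup_k F k) x by rewrite -gF.
  case=> j _ Fj; exists j => // k /= jk.
  have jk1 : (j < k.+1)%N by [].
  apply/eqP/prodf_eq0; exists (Ordinal jk1) => //=.
  by move: Fj; case: (hP j) => _ _ -> /= ->.
Qed.

Lemma countable_dense_seq (R : realType) :
  exists r : nat -> R, forall x y, x < y -> exists i, x < r i < y.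
Proof.
exists (fun i => ratr (odflt 0 (unpickle i : option rat))) => x y.
move=> /rat_in_itvoo[q]; rewrite in_itv /= => qxy.
by exists (pickle q); rewrite pickleK.
Qed.

(** Lebesgue-Hausdorff: the k-th approximation is a continuous function that
    lies on the correct side of the first k + 1 levels of a countable dense set,
    at the points where the k-th zero set already witnesses which side is
    correct. For a fixed x and e, two levels close to g x on either side
    eventually enclose the approximations. *)
Lemma first_functional_Lebesgue_limit (R : realType) (X : topologicalType)
    (g : X -> R) :
  first_functional_Lebesgue R g ->
  exists2 u : nat -> X -> R, forall k, continuous (u k) &
    forall x, u^~ x @ \oo --> g x.
Proof.
move=> hg; have [r r_dense] := countable_dense_seq R.
have /choice[a aP] i := functional_Fsigma_detect hg (@open_lt R (r i)).
have /choice[b bP] i := functional_Fsigma_detect hg (@open_gt R (r i)).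
have /choice[u uP] k : exists f : X -> R, continuous f /\
    forall i : 'I_k.+1, forall x,
    (a i k x = 0 -> f x <= r i) /\ (b i k x = 0 -> r i <= f x).
  have [||||i j x rij|f] := @interpolation R X k (fun i => r i)
    (fun i => a i k) (fun i => b i k).
  - by move=> i x; case: (aP i).
  - by move=> i x; case: (bP i).
  - by move=> i; case: (aP i).
  - by move=> i; case: (bP i).
  - case: (aP i) (bP j) => _ _ + _ [_ _ + _] => /(_ k x) + /(_ k x).
    move=> + + a0 b0 => /(_ a0) /= gi /(_ b0) /= gj.
    by have := lt_trans gi (lt_trans rij gj); rewrite ltxx.
  by exists f.
exists u => [k|x]; first by case: (uP k).
apply/cvgrPdist_le => e e0.
have [i /andP[gi ie]] : exists i, g x < r i < g x + e.
  by apply: r_dense; rewrite ltrDl.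
have [j /andP[ej jg]] : exists j, g x - e < r j < g x.
  by apply: r_dense; rewrite gtrBl.
have [_ _ _ /(_ x gi) ai] := aP i.
have [_ _ _ /(_ x jg) bj] := bP j.
near=> k.
have ik : (i < k.+1)%N.
  by rewrite ltnS; near: k; exact: nbhs_infty_ge.
have jk : (j < k.+1)%N.
  by rewrite ltnS; near: k; exact: nbhs_infty_ge.
have [_ uk] := uP k.
have [/(_ _)/= ui _] := uk (Ordinal ik) x.
have [_ /(_ _)/= uj] := uk (Ordinal jk) x.
have {}ui : u k x <= r i by apply: ui; near: k.
have {}uj : r j <= u k x by apply: uj; near: k.
rewrite ler_distlC; apply/andP; split; lra.
Unshelve. all: by end_near. Qed.

(** * Separately continuous functions with a given diagonal *)

(** The weight is nonincreasing in k, equals 1 as long as the first terms of u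
    and v agree well enough, and vanishes for good after u and v differ at some
    index. When u and v are the sequences of values at x and y of functions
    g_k, it plays the part of a cut-off in the distance of x and y, for the
    pseudometric generated by the g_k. *)
Definition blend_weight (R : realType) (u v : nat -> R) (k : nat) : R :=
  Num.max 0 (Num.min 1 (2 - k.+1%:R * \sum_(j < k.+2) `|u j - v j|)).

(** Summing by parts shows a convex combination of u 0, ..., u K: the coefficient
    of u k is the drop of the weight from k - 1 to k, with initial weight 1, and
    u K takes what is left. *)
Definition blend_partial (R : realType) (u v : nat -> R) (K : nat) : R :=
  u 0%N + \sum_(k < K) blend_weight u v k * (u k.+1 - u k).

Definition blend (R : realType) (u v : nat -> R) : R :=
  lim (blend_partial u v @ \oo).

Section BlendTheory.
Variables (R : realType) (u v : nat -> R).
Local Notation w := (blend_weight u v).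

Lemma blend_weight_ge0 k : 0 <= w k.
Proof. by rewrite le_max lexx. Qed.

Lemma blend_weight_le1 k : w k <= 1.
Proof. by rewrite ge_max ler01 ge_min lexx. Qed.

Lemma blend_weight_eq1 k :
  k.+1%:R * \sum_(j < k.+2) `|u j - v j| <= 1 -> w k = 1.
Proof.
move=> le1; rewrite /blend_weight min_l; last by lra.
by rewrite max_r.
Qed.

Lemma blend_weight_eq0 k :
  2 <= k.+1%:R * \sum_(j < k.+2) `|u j - v j| -> w k = 0.
Proof.
move=> ge2; apply: max_l; rewrite ge_min; apply/orP; right; lra.
Qed.

Lemma blend_weight_gt0 k :
  0 < w k -> k.+1%:R * \sum_(j < k.+2) `|u j - v j| < 2.
Proof.
by rewrite ltNge => w0; rewrite ltNge; apply: contra w0 => /blend_weight_eq0 ->.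
Qed.

Lemma blend_weight_nonincreasing k : w k.+1 <= w k.
Proof.
rewrite /blend_weight [leRHS]maxC ge_max !le_max lexx orbT /= orbC.
rewrite le_min !ge_min lexx /=; apply/orP; right; apply/orP; right.
rewrite lerD2l lerN2; apply: ler_pM => //; first exact: sumr_ge0.
  by rewrite ler_nat.
by rewrite [leRHS]big_ord_recr /= lerDl.
Qed.

Lemma blend_partialS K :
  blend_partial u v K.+1 = blend_partial u v K + w K * (u K.+1 - u K).
Proof. by rewrite /blend_partial big_ord_recr addrA. Qed.

Lemma blend_partial_id K :
  (forall k, (k < K)%N -> w k = 1) -> blend_partial u v K = u K.
Proof.
elim: K => [|K IH] w1; first by rewrite /blend_partial big_ord0 addr0.
rewrite blend_partialS IH => [|k kK]; last by rewrite w1 // ltnS ltnW.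
by rewrite w1 // mul1r addrC subrK.
Qed.

Lemma blend_partial_stationary j K :
  (j <= K.+1)%N -> 2 <= K.+1%:R * `|u j - v j| ->
  forall k, (K <= k)%N -> blend_partial u v k = blend_partial u v K.
Proof.
move=> jK Kj; elim=> [|k IH]; first by rewrite leqn0 => /eqP ->.
rewrite leq_eqVlt => /orP[/eqP -> //|]; rewrite ltnS => Kk.
rewrite blend_partialS IH // blend_weight_eq0 ?mul0r ?addr0 //.
apply: (le_trans Kj); apply: ler_pM => //; first by rewrite ler_nat.
have jk : (j < k.+2)%N by rewrite (leq_ltn_trans jK).
by rewrite (bigD1 (Ordinal jk)) //= lerDl sumr_ge0.
Qed.

(** The partial sum is a convex combination of those u k with m < k for which
    the weight at k - 1 has not vanished yet, and all of these are near c. *)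
Lemma blend_partial_near m (c e : R) :
  (forall k, (k <= m)%N -> w k = 1) ->
  (forall k, (m <= k)%N -> 0 < w k -> `|u k.+1 - c| <= e) ->
  forall K, (m < K)%N -> `|blend_partial u v K - c| <= e.
Proof.
move=> w1 uc.
(* The difference on the left collects the part of the convex combination whose
   coefficients are final; their total is 1 - w k. *)
have inv k : (m < k)%N ->
    `|blend_partial u v k - c - w k * (u k - c)| <= (1 - w k) * e.
  elim: k => // k IH; rewrite ltnS leq_eqVlt => /orP[/eqP mk|mk].
    rewrite blend_partial_id; last by move=> i; rewrite ltnS -mk => /w1.
    rewrite -[X in X - _]mul1r -mulrBl normrM ger0_norm; last first.
      by rewrite subr_ge0 blend_weight_le1.
    apply: ler_wpM2l; first by rewrite subr_ge0 blend_weight_le1.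
    by apply: uc; rewrite ?mk // w1 ?mk.
  have wk := blend_weight_nonincreasing k; have wS := blend_weight_ge0 k.+1.
  have -> : blend_partial u v k.+1 - c - w k.+1 * (u k.+1 - c) =
      (blend_partial u v k - c - w k * (u k - c)) +
      (w k - w k.+1) * (u k.+1 - c) by rewrite blend_partialS; ring.
  have -> : (1 - w k.+1) * e = (1 - w k) * e + (w k - w k.+1) * e by ring.
  apply: (le_trans (ler_normD _ _)); apply: lerD; first exact: IH.
  rewrite normrM ger0_norm ?subr_ge0 //.
  have [w0|w0] := ltP 0 (w k).
    by apply: ler_wpM2l; [rewrite subr_ge0|apply: uc => //; exact: ltnW].
  have -> : w k - w k.+1 = 0 by lra.
  by rewrite !mul0r.
move=> [//|K] mK; have := inv _ mK.
have wS := blend_weight_ge0 K.+1.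
have wuc : `|w K.+1 * (u K.+1 - c)| <= w K.+1 * e.
  rewrite normrM ger0_norm //.
  have [w0|w0] := ltP 0 (w K.+1).
    apply: ler_wpM2l => //; apply: uc => //.
    exact: lt_le_trans (blend_weight_nonincreasing _).
  have -> : w K.+1 = 0 by lra.
  by rewrite !mul0r.
move=> ih; rewrite -[X in `|X|](subrK (w K.+1 * (u K.+1 - c))).
apply: (le_trans (ler_normD _ _)).
have -> : e = (1 - w K.+1) * e + w K.+1 * e by ring.
exact: lerD.
Qed.

Lemma blend_partial_cvg_stationary j K :
  (j <= K.+1)%N -> 2 <= K.+1%:R * `|u j - v j| ->
  blend_partial u v @ \oo --> blend_partial u v K.
Proof.
move=> jK Kj; apply: cvg_near_cst; exists K => // k Kk.
exact: blend_partial_stationary Kj _ Kk.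
Qed.

End BlendTheory.

Lemma blend_partial_cvg_diag (R : realType) (u : nat -> R) (l : R) :
  u @ \oo --> l -> blend_partial u u @ \oo --> l.
Proof.
move=> ul; apply: cvg_trans ul.
apply: near_eq_cvg; apply: nearW => K; rewrite blend_partial_id // => k _.
apply: blend_weight_eq1; rewrite big1 ?mulr0 // => i _.
by rewrite subrr normr0.
Qed.

Lemma large_multiple (R : realType) (d e : R) (j : nat) :
  0 < d -> exists2 K, (j <= K)%N & e <= K.+1%:R * d.
Proof.
move=> d0; exists (maxn j (Num.truncn (e / d))); first exact: leq_maxl.
rewrite -ler_pdivrMr //; apply: ltW; apply: lt_le_trans (truncnS_gt _) _.
by rewrite ler_nat ltnS leq_maxr.
Qed.

Lemma blend_partial_cvg (R : realType) (u v c : nat -> R) (l : R) :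
  (forall k, `|u k - c k| <= `|u k - v k|) -> c @ \oo --> l ->
  cvgn (blend_partial u v).
Proof.
move=> ucv cl; have [[j uvj]|/forallNP uv] := pselect (exists j, u j != v j).
  have d0 : 0 < `|u j - v j| by rewrite normr_gt0 subr_eq0.
  have [K jK Kd] := large_multiple 2 j d0.
  by apply/cvg_ex; eexists; apply: blend_partial_cvg_stationary Kd; exact: leqW.
have uvE : u = v.
  by apply/funext => k; have /negP := uv k; rewrite negbK => /eqP.
have uc : u = c.
  apply/funext => k; apply/eqP.
  by rewrite -subr_eq0 -normr_le0 (le_trans (ucv k)) // uvE subrr normr0.
by apply/cvg_ex; exists l; rewrite -uvE uc; exact: blend_partial_cvg_diag.
Qed.

Lemma blend_diag (R : realType) (u : nat -> R) (l : R) :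
  u @ \oo --> l -> blend u u = l.
Proof. by move=> ul; apply: cvg_lim => //; exact: blend_partial_cvg_diag. Qed.

Lemma continuous_blend_partial (R : realType) (T : topologicalType)
    (a b : nat -> T -> R) K :
  (forall k, continuous (a k)) -> (forall k, continuous (b k)) ->
  continuous (fun z => blend_partial (a^~ z) (b^~ z) K).
Proof.
move=> ac bc.
have wc k : continuous (fun z => blend_weight (a^~ z) (b^~ z) k).
  move=> z; apply: (@continuous_max R T (cst 0) (fun z => Num.min 1 _)).
    exact: cvg_cst.
  apply: (@continuous_min R T (cst 1) (fun z => _)); first exact: cvg_cst.
  apply: cvgB; first exact: cvg_cst.
  apply: cvgM; first exact: cvg_cst.
  apply: continuous_sumr => j _ {}z.
  by apply: cvg_norm; apply: cvgB; [exact: ac|exact: bc].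
move=> z; apply: cvgD; first exact: ac.
apply: continuous_sumr => k _ {}z; apply: cvgM; first exact: wc.
by apply: cvgB; exact: ac.
Qed.

(** The hypothesis relating a, b and c covers both variables of
    (x, y) |-> blend (g_. x) (g_. y): for a fixed y take c k = g_k y, which
    makes it an equality, and for a fixed x take c k = g_k x, which makes its
    left side zero. If a and b differ at z0 for some index, the sums are
    stationary from a common index on near z0. Otherwise the value at z0 is l,
    and near z0 only terms a k z with large k contribute, with
    `|a k z - b k z| small, so that a k z is near c k, hence near l. *)
Lemma blend_continuous (R : realType) (T : topologicalType)
    (a b : nat -> T -> R) (c : nat -> R) (l : R) :
  (forall k, continuous (a k)) -> (forall k, continuous (b k)) ->
  (forall k z, `|a k z - c k| <= `|a k z - b k z|) ->
  c @ \oo --> l ->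
  continuous (fun z => blend (a^~ z) (b^~ z)).
Proof.
move=> ac bc abc cl z0.
have dc k : continuous (fun z => `|a k z - b k z|).
  by move=> z; apply: cvg_norm; apply: cvgB; [exact: ac|exact: bc].
have [[j abj]|/forallNP ab] := pselect (exists j, a j z0 != b j z0).
  set d := `|a j z0 - b j z0|.
  have d0 : 0 < d by rewrite normr_gt0 subr_eq0.
  (* The factor 4 leaves K.+1 * (d / 2) at least 2 at the neighbours of z0. *)
  have [K jK Kd] := large_multiple 4 j d0.
  have near_stat : \forall z \near z0,
      blend_partial (a^~ z) (b^~ z) K = blend (a^~ z) (b^~ z).
    have : \forall z \near z0, d / 2 < `|a j z - b j z|.
      by apply: (cvgr_gt _ (dc j z0)); rewrite -/d; lra.
    apply: filterS => z dz; apply/esym/cvg_lim => //.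
    apply: (@blend_partial_cvg_stationary _ _ _ j); first exact: leqW.
    have := ler_wpM2l (ler0n R K.+1) (ltW dz); rewrite mulrA; lra.
  apply: cvg_trans (near_eq_cvg near_stat) _.
  rewrite /continuous_at -(nbhs_singleton near_stat).
  exact: continuous_blend_partial.
have abz0 k : a k z0 = b k z0 by have /negP := ab k; rewrite negbK => /eqP.
have ck k : a k z0 = c k.
  apply/eqP; rewrite -subr_eq0 -normr_le0 (le_trans (abc k z0)) //.
  by rewrite abz0 subrr normr0.
rewrite /continuous_at; have -> : blend (a^~ z0) (b^~ z0) = l.
  rewrite (_ : a^~ z0 = c); last exact/funext.
  rewrite (_ : b^~ z0 = c); last by apply/funext => k; rewrite -abz0.
  exact: blend_diag.
apply/cvgrPdist_le => e e0.
have e20 : 0 < e / 2 by lra.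
have [m0 _ cm0] : \forall k \near \oo, `|l - c k| <= e / 2.
  by move/cvgrPdist_le : cl; exact.
have [m m0m me] := large_multiple 2 m0 e20.
have : \forall z \near z0, \sum_(j < m.+2) `|a j z - b j z| < m.+1%:R^-1.
  have sc : continuous (fun z => \sum_(j < m.+2) `|a j z - b j z|).
    exact: continuous_sumr.
  apply: (cvgr_lt _ (sc z0)); rewrite big1 ?invr_gt0 // => j _.
  by rewrite abz0 subrr normr0.
apply: filterS => z sz.
have w1 k : (k <= m)%N -> blend_weight (a^~ z) (b^~ z) k = 1.
  move=> km; apply: blend_weight_eq1.
  rewrite -[leRHS](@mulfV _ m.+1%:R) ?pnatr_eq0 //.
  apply: ler_pM => //; [exact: sumr_ge0|by rewrite ler_nat|].
  apply: le_trans (ltW sz).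
  rewrite -!(big_mkord xpredT (fun j => `|a j z - b j z|)).
  by rewrite [leRHS](@big_cat_nat _ _ _ k.+2) //= lerDl sumr_ge0.
have near_l K : (m < K)%N -> `|blend_partial (a^~ z) (b^~ z) K - l| <= e.
  apply: blend_partial_near => // k mk /blend_weight_gt0 wk.
  have ak : `|a k.+1 z - b k.+1 z| <= e / 2.
    have mk1 : m.+1%:R <= k.+1%:R :> R by rewrite ler_nat.
    rewrite -(@ler_pM2l _ k.+1%:R) //; apply: (@le_trans _ _ 2); last first.
      by apply: (le_trans me); rewrite ler_pM2r.
    apply: le_trans (ltW wk); apply: ler_wpM2l => //.
    by rewrite big_ord_recr /= lerDr sumr_ge0.
  have ck1 : `|l - c k.+1| <= e / 2.
    by apply: cm0 => /=; rewrite (leq_trans m0m) // leqW.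
  rewrite distrC in ck1.
  have -> : a k.+1 z - l = (a k.+1 z - c k.+1) + (c k.+1 - l) by ring.
  apply: (le_trans (ler_normD _ _)).
  have := abc k.+1 z; lra.
have bc_cvg : cvgn (blend_partial (a^~ z) (b^~ z)).
  exact: (blend_partial_cvg (abc^~ z) cl).
rewrite distrC ler_distl; apply/andP; split.
  apply: limr_ge => //; exists m.+1 => // K mK.
  by have := near_l K mK; rewrite ler_distl => /andP[].
apply: limr_le => //; exists m.+1 => // K mK.
by have := near_l K mK; rewrite ler_distl => /andP[].
Qed.

(** The separately continuous function is F x y = blend (u_. x) (u_. y), for a
    sequence u of continuous functions converging pointwise to g. *)
Lemma separately_continuous_diagonal (R : realType) (X : topologicalType)
    (g : X -> R) :
  first_functional_Lebesgue R g ->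
  exists F : X -> X -> R,
    [/\ forall x, continuous (F x), forall y, continuous (F^~ y)
      & forall x, F x x = g x].
Proof.
move=> /first_functional_Lebesgue_limit[u uc ug].
exists (fun x y => blend (u^~ x) (u^~ y)); split=> x.
- apply: (blend_continuous (a := fun k _ => u k x) (c := u^~ x)) (ug x) => //.
    by move=> k y; exact: cvg_cst.
  by move=> k y; rewrite subrr normr0.
- apply: (blend_continuous (b := fun k _ => u k x) (c := u^~ x)) (ug x) => //.
  by move=> k y; exact: cvg_cst.
- exact: blend_diag.
Qed.

(** * Projections in the pluri-fine topology *)

Lemma subharmonic_sub (R : realType) (V W : set R[i]) (v : R[i] -> \bar R) :
  W `<=` V -> (exists2 z, W z & v z <> -oo%E) ->
  subharmonic V v -> subharmonic W v.
Proof.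
move=> WV Wv [vlty vusc _ vmean]; split=> //.
- by move=> z /WV/vlty.
- move=> z a Wz vza; have := vusc z a (WV _ Wz) vza.
  by rewrite !near_withinE; apply: filterS => y Vy /WV.
- by move=> c r r0 cr; apply: vmean => //; exact: subset_trans WV.
Qed.

(** A complex line is mapped by p into a complex line, and the component of its
    trace on W into a component of the trace on U. On the smaller component the
    pulled back function may become identically -oo, which the definition
    allows; otherwise it inherits subharmonicity. *)
Lemma psh_comp_linear (R : realType) (N M : nat) (U : set 'rV[R[i]]_N)
    (W : set 'rV[R[i]]_M) (p : {linear 'rV[R[i]]_M -> 'rV[R[i]]_N})
    (u : 'rV[R[i]]_N -> \bar R) :
  continuous p -> (forall z, W z -> U (p z)) -> psh U u -> psh W (u \o p).
Proof.
move=> pc pWU [ulty uusc uline]; split.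
- by move=> z /pWU/ulty.
- move=> z a Wz uza.
  have := uusc (p z) a (pWU _ Wz) uza.
  rewrite !near_withinE => /(pc z).
  by apply: (@filterS _ (nbhs z)) => y /= Uy /pWU.
move=> a b z0 Wz0 V.
have pE z : p (a + z *: b) = p a + z *: p b by rewrite linearD linearZ.
have Uz0 : U (p a + z0 *: p b) by rewrite -pE; exact: pWU.
pose V' := connected_component [set z | U (p a + z *: p b)] z0.
have VV' : V `<=` V'.
  apply: connected_component_max.
  - exact: connected_component_refl.
  - move=> z /connected_component_sub /=; rewrite -pE; exact: pWU.
  - exact: component_connected.
have -> : (fun z => (u \o p) (a + z *: b)) = (fun z => u (p a + z *: p b)).
  by apply/funext => z /=; rewrite pE.
case: (uline (p a) (p b) z0 Uz0) => [sh|noo]; last first.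
  by right=> z /VV' Vz; rewrite /= pE; exact: noo.
have [ex|nex] := pselect (exists2 z, V z & u (p a + z *: p b) <> -oo%E).
  by left; exact: subharmonic_sub sh.
right=> z Vz; rewrite /= pE; apply: contrapT => uz; apply: nex.
by exists z.
Qed.

Lemma plurifine_continuous (R : realType) (N : nat) (U : set 'rV[R[i]]_N)
    (T : topologicalType) (f : T -> plurifine U) :
  (forall u, psh U u -> continuous (fun t => u (\val (f t)))) ->
  continuous f.
Proof.
move=> fu t; apply/cvg_sup => -[u psh_u].
have := @continuous_comp_initial U T (\bar R) (fun x : U => u (\val x)) f.
by apply; exact: fu.
Qed.

Lemma psh_plurifine_continuous (R : realType) (N : nat) (U : set 'rV[R[i]]_N)
    (u : 'rV[R[i]]_N -> \bar R) :
  psh U u -> continuous (fun x : plurifine U => u (\val x)).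
Proof.
move=> psh_u x.
have /cvg_sup/(_ (exist _ u psh_u)) : nbhs x --> x by [].
move=> xx A /(@initial_continuous U (\bar R) (fun y : U => u (\val y)) x).
exact: xx.
Qed.

Definition plurifine_map (R : realType) (N M : nat) (U : set 'rV[R[i]]_N)
    (W : set 'rV[R[i]]_M) (p : 'rV[R[i]]_M -> 'rV[R[i]]_N)
    (pWU : forall z, W z -> U (p z)) (z : plurifine W) : plurifine U :=
  exist (fun x => x \in U) (p (\val z)) (mem_set (pWU _ (set_valP z))).

Lemma plurifine_map_continuous (R : realType) (N M : nat)
    (U : set 'rV[R[i]]_N) (W : set 'rV[R[i]]_M)
    (p : {linear 'rV[R[i]]_M -> 'rV[R[i]]_N})
    (pWU : forall z, W z -> U (p z)) :
  continuous p -> continuous (plurifine_map pWU).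
Proof.
move=> pc; apply: plurifine_continuous => u psh_u.
exact: (psh_plurifine_continuous (psh_comp_linear pc pWU psh_u)).
Qed.

(** The projections of Om x Om are continuous for the pluri-fine topologies.
    On a slice, f is a partial function of F composed with one of them, and this
    composite is continuous on the whole of Om x Om. *)
Lemma separately_continuous_sqpair (R : realType) (n : nat)
    (Om : set 'rV[R[i]]_n) (F : plurifine Om -> plurifine Om -> R) :
  (forall x, continuous (F x)) -> (forall y, continuous (F^~ y)) ->
  exists2 f : plurifine (square Om) -> R,
    separately_continuous f & forall x y, f (sqpair x y) = F x y.
Proof.
move=> Fr Fl.
have lP (z : 'rV[R[i]]_(n + n)) : square Om z -> Om (lsubmx z) by case.
have rP (z : 'rV[R[i]]_(n + n)) : square Om z -> Om (rsubmx z) by case.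
pose l := plurifine_map lP; pose r := plurifine_map rP.
have lE x y : l (sqpair x y) = x by apply: val_inj; rewrite /= row_mxKl.
have rE x y : r (sqpair x y) = y by apply: val_inj; rewrite /= row_mxKr.
have lc : continuous l.
  by apply: plurifine_map_continuous; exact: continuous_lsubmx.
have rc : continuous r.
  by apply: plurifine_map_continuous; exact: continuous_rsubmx.
exists (fun z => F (l z) (r z)); last by move=> x y; rewrite lE rE.
move=> x y; split.
  apply: (@subspace_eq_continuous _ _ _ (F^~ y \o l)).
    by move=> _ /set_mem[t _ <-]; exact: (congr1 (F _) (esym (rE t y))).
  apply: continuous_subspaceT => z.
  by apply: continuous_comp; [exact: lc|exact: Fl].
apply: (@subspace_eq_continuous _ _ _ (F x \o r)).
  by move=> _ /set_mem[t _ <-]; exact: (congr1 (F^~ _) (esym (lE x t))).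
apply: continuous_subspaceT => z.
by apply: continuous_comp; [exact: rc|exact: Fr].
Qed.

Theorem theorem2p6 (R : realType) (n : nat) (hn : (0 < n)%N)
    (Om : set 'rV[R[i]]_n) (Om_open : open Om) (Om_neq0 : Om !=set0)
    (g : plurifine Om -> R) (hg : first_functional_Lebesgue R g) :
  exists f : plurifine (square Om) -> R,
    separately_continuous f /\ forall x : plurifine Om, g x = f (sqpair x x).
Proof.
have [F [Fr Fl Fd]] := separately_continuous_diagonal hg.
have [f fsc fE] := separately_continuous_sqpair Fr Fl.
by exists f; split=> // x; rewrite fE Fd.
Qed.
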